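(* A metric space $X$ is $\mathcal H$-null if and only if $X$ has strong measure zero.
   Context: A separable metric space $X$ is $\mathcal H$-null if $\dim_H f(X)=0$ for every uniformly continuous map $f$ from $X$ into a metric space, where $\dim_H$ is Hausdorff dimension. A metric space $X$ has strong measure zero if for any sequence $\langle\varepsilon_n\rangle\in(0,\infty)^\omega$ there is a cover $\{U_n:n\in\omega\}$ of $X$ such that $\operatorname{diam}U_n\le\varepsilon_n$ for all $n$. *)

(* Defs.v *)
From HB Require Import structures.
From mathcomp Require Import all_boot all_order all_algebra.
From mathcomp Require Import all_classical all_reals all_analysis.

Set Implicit Arguments.
Unset Strict Implicit.
Unset Printing Implicit Defensive.

Import Order.TTheory GRing.Theory Num.Theory.

Local Open Scope classical_set_scope.
Local Open Scope ring_scope.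
Local Open Scope ereal_scope.

Definition separable_space (T : topologicalType) : Prop :=
  exists2 D : set T, countable D & dense D.

(* The element 0 is added so that the empty set has diameter 0, not -oo. *)
Definition diam (R : realType) (X : metricType R) (A : set X) : \bar R :=
  ereal_sup ([set 0] `|` [set (mdist x y)%:E | x in A & y in A]).

(* Countable covers suffice: finite ones are padded with empty sets, which
   contribute 0 `^ s = 0 when s > 0, the only exponents used below. *)
Definition hausdorff_content (R : realType) (X : metricType R)
    (s delta : R) (E : set X) : \bar R :=
  ereal_inf [set \sum_(0 <= n <oo) (diam (U n) `^ s) | U in
    [set U : (set X)^nat | E `<=` \bigcup_n U n /\
                           forall n, diam (U n) <= delta%:E]].

Definition hausdorff_measure (R : realType) (X : metricType R)
    (s : R) (E : set X) : \bar R :=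
  ereal_sup [set hausdorff_content s delta E |
    delta in [set delta : R | (0 < delta)%R]].

(* inf {s > 0 : H^s(E) = 0}, which is +oo when no such s exists. *)
Definition hausdorff_dim (R : realType) (X : metricType R)
    (E : set X) : \bar R :=
  ereal_inf [set s%:E | s in
    [set s : R | (0 < s)%R /\ hausdorff_measure s E = 0]].

(* The dimension of the image is computed with covers by subsets of Y;
   intersecting them with the image shows that it is intrinsic. *)
Definition H_null (R : realType) (X : metricType R) : Prop :=
  separable_space X /\
  forall (Y : metricType R) (f : X -> Y),
    unif_continuous f -> hausdorff_dim (range f) = 0.

Definition strong_measure_zero (R : realType) (X : metricType R) : Prop :=
  forall eps : nat -> R, (forall n, (0 < eps n)%R) ->
    exists U : nat -> set X,
      [set: X] `<=` \bigcup_n U n /\ forall n, diam (U n) <= (eps n)%:E.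

(* Main.v *)
(** Strong measure zero passes to uniformly continuous images, and a cover of
    [Y] by sets of diameter at most (e / 2^(n+1))^(1/s) shows H^s(Y) <= e.

    Conversely, given eps, remetrize X by the uniformly equivalent metric
    h(d(x,y)) with h(t) = sup_n min(1/(n+1), t/eps_n).  As the new space has
    dimension 0 it has a cover (U_k) with sum_k diam(U_k) < 1.  Arranging the
    U_k by decreasing diameter, the n-th one has diameter < 1/(n+1) for the new
    metric, which means that its diameter for d is at most eps_n. *)
Require Import Defs.
From HB Require Import structures.
From mathcomp Require Import all_boot all_order all_algebra.
From mathcomp Require Import all_classical all_reals all_analysis.
From mathcomp Require Import lra.

Set Implicit Arguments.
Unset Strict Implicit.
Unset Printing Implicit Defensive.

Import Order.TTheory GRing.Theory Num.Theory.
Import numFieldNormedType.Exports.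

Local Open Scope classical_set_scope.
Local Open Scope ring_scope.

(** * Ranking the terms of a summable sequence by size *)

Section Rank.
Variables (R : realType) (a : nat -> R).
Hypothesis a_gt0 : forall k, 0 < a k.
Hypothesis a_sum : forall n, \sum_(0 <= i < n) a i <= 1.

(* [i] precedes [k] when terms are arranged by decreasing size, ties being
   broken by the index. *)
Let before (k i : nat) := (a k < a i) || ((a i == a k) && (i <= k)%N).

Let before_refl k : before k k.
Proof. by rewrite /before eqxx leqnn orbT. Qed.

Let before_le k i : before k i -> a k <= a i.
Proof. by case/orP => [/ltW//|/andP[/eqP->]]. Qed.

Let before_trans k j i : before k j -> before j i -> before k i.
Proof.
rewrite /before => /orP[kj|/andP[/eqP jk jlek]] /orP[ji|/andP[/eqP ij ilej]].
- by rewrite (lt_trans kj ji).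
- by rewrite ij kj.
- by rewrite -jk ji.
- by rewrite ij jk eqxx (leq_trans ilej jlek) orbT.
Qed.

Let before_anti k i : before k i -> before i k -> i = k.
Proof.
rewrite /before => /orP[ki|/andP[/eqP ik ilek]].
  by rewrite ltNge (ltW ki)/= (lt_eqF ki).
by rewrite ik ltxx eqxx/= => klei; apply/eqP; rewrite eqn_leq ilek.
Qed.

Let before_total k i : before k i \/ before i k.
Proof.
rewrite /before; have [ki|ik|_] := ltgtP (a k) (a i); [by left|by right|].
by case: (leqP i k) => [|/ltnW ->]; [left|right].
Qed.

Let cvg_terms : a @ \oo --> 0.
Proof.
apply: (@cvg_series_cvg_0 R R); apply: nondecreasing_is_cvgn.
  by apply: nondecreasing_series => n _ _; exact: ltW.
by exists 1 => _ [n _ <-]; exact: a_sum.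
Qed.

Let before_finite k : exists N, forall i, before k i -> (i < N)%N.
Proof.
have /cvgr0Pnorm_lt/(_ _ (a_gt0 k))[N _ aN] := cvg_terms.
exists N => i /before_le ki; rewrite ltnNge; apply/negP => /aN/=.
by rewrite gtr0_norm// ltNge ki.
Qed.

(** The terms tend to 0, so only finitely many precede a given one. If [m] terms, [k] included, come
    no later than [k], each is at least [a k], whence [m * a k <= 1]; the rank is [m - 1]. *)
Lemma summable_rank : exists2 f : nat -> nat, injective f &
  forall k, a k <= (f k).+1%:R^-1.
Proof.
have [N beforeN] := choice before_finite.
pose L k := [seq i <- iota 0 (N k) | before k i].
have memL k i : (i \in L k) = before k i.
  rewrite mem_filter mem_iota add0n leq0n/=.
  by case: (boolP (before k i)) => // /beforeN ->.
have uniqL k : uniq (L k) by rewrite filter_uniq// iota_uniq.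
have sizeL k : (size (L k)).-1.+1 = size (L k).
  by rewrite prednK// -has_predT; apply/hasP; exists k; rewrite ?memL.
(* Transitivity puts [L k] inside [L k'], and antisymmetry makes [k'] a new element. Distinct
   indices thus get distinct ranks. *)
have ltL k k' : before k' k -> k != k' -> (size (L k) < size (L k'))%N.
  move=> bk kk'; apply: (@uniq_leq_size _ (k' :: L k)).
    rewrite cons_uniq uniqL andbT memL; apply: contraNN kk' => k'k.
    by apply/eqP/before_anti.
  by move=> i; rewrite inE !memL => /orP[/eqP->//|]; exact: before_trans.
exists (fun k => (size (L k)).-1) => [k k' /(congr1 S)|k]; rewrite !sizeL.
  move=> eqsz; apply/eqP/negPn/negP => kk'.
  case: (before_total k k') => b; last first.
    by have := ltL _ _ b kk'; rewrite eqsz ltnn.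
  by have := ltL _ _ b; rewrite eq_sym eqsz ltnn => /(_ kk').
have size_gt0 : 0 < (size (L k))%:R :> R by rewrite ltr0n -sizeL.
rewrite -[leRHS]mul1r ler_pdivlMr// mulr_natr.
apply: le_trans (a_sum (N k)).
have -> : a k *+ size (L k) = \sum_(i <- L k) a k.
  by rewrite big_const_seq iter_addr_0 count_predT.
apply: (@le_trans _ _ (\sum_(i <- L k) a i)).
  by rewrite big_seq [leRHS]big_seq ler_sum// => i; rewrite memL => /before_le.
rewrite /L big_filter /index_iota subn0 big_mkcond ler_sum// => i _.
by case: ifP => // _; exact: ltW.
Qed.

End Rank.

(** * The gauge and the metric it induces *)

Section Gauge.
Variables (R : realType) (eps : nat -> R).

Definition gauge_term (x : R) (n : nat) : R := Num.min n.+1%:R^-1 (x / eps n).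

Definition gauge (x : R) : R := sup (range (gauge_term x)).

Hypothesis eps_gt0 : forall n, 0 < eps n.

Lemma gauge_ge x n : gauge_term x n <= gauge x.
Proof.
apply: ub_le_sup; last by exists n.
exists 1 => _ [m _ <-]; rewrite ge_min invf_le1// ?ler1n//.
Qed.

Lemma gauge_le x c : (forall n, gauge_term x n <= c) -> gauge x <= c.
Proof.
by move=> xc; apply: ge_sup => [|_ [n _ <-]//]; exists (gauge_term x 0), 0%N.
Qed.

Lemma gauge0 : gauge 0 = 0.
Proof.
have gt n : gauge_term 0 n = 0 by rewrite /gauge_term mul0r; apply/min_r.
apply/eqP; rewrite eq_le; apply/andP; split; last first.
  by rewrite -[leLHS](gt 0%N) gauge_ge.
by apply: gauge_le => n; rewrite gt.
Qed.

Lemma gauge_gt0 x : 0 < x -> 0 < gauge x.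
Proof.
move=> x0; apply: lt_le_trans (gauge_ge x 0).
by rewrite lt_min invr1 ltr01 divr_gt0.
Qed.

(** Truncation at a positive level is subadditive on nonnegative reals, and this passes to the
    supremum. Taking [z <= x + y] also builds in monotonicity, as the triangle inequality
    requires. *)
Lemma gauge_subadditive x y z : 0 <= x -> 0 <= y -> z <= x + y ->
  gauge z <= gauge x + gauge y.
Proof.
move=> x0 y0 zxy; apply: gauge_le => n.
apply: le_trans (lerD (gauge_ge x n) (gauge_ge y n)).
have n0 : 0 < n.+1%:R^-1 :> R by rewrite invr_gt0.
have {zxy} : z / eps n <= x / eps n + y / eps n.
  by rewrite -mulrDl ler_pM2r// invr_gt0.
have : 0 <= x / eps n by rewrite divr_ge0// ltW.
have : 0 <= y / eps n by rewrite divr_ge0// ltW.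
rewrite /gauge_term.
move: n.+1%:R^-1 n0 (x / _) (y / _) (z / _) => a a0 u v w v0 u0 wuv.
have : Num.min a w <= w by rewrite ge_min lexx orbT.
have : Num.min a w <= a by rewrite ge_min lexx.
by move: (Num.min a w) => m; case: (leP a u); case: (leP a v); lra.
Qed.

(** The [n]-th term lies below its cut-off, so the minimum is [x / eps n], which is then less than
    1. *)
Lemma gauge_lt_inv x n : gauge x < n.+1%:R^-1 -> x <= eps n.
Proof.
move=> xn; have := le_lt_trans (gauge_ge x n) xn.
rewrite gt_min ltxx/= => /lt_le_trans/(_ (_ : _ <= 1)).
rewrite invf_le1// ler1n => /(_ isT).
by rewrite ltr_pdivrMr// mul1r => /ltW.
Qed.

(** The cut-off controls all terms beyond some [N]; the finitely many others are linear in [x].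
    Aiming at [e / 2] keeps the inequality strict after the supremum. *)
Lemma gauge_near0 e : 0 < e ->
  exists2 d, 0 < d & forall x, x < d -> gauge x < e.
Proof.
move=> e0; pose N := Num.truncn (e / 2)^-1.
have [d d0 dN] : exists2 d, 0 < d & forall n, (n <= N)%N -> d <= e / 2 * eps n.
  elim: N => [|N [d d0 dN]].
    by exists (e / 2 * eps 0) => [|[]//]; rewrite mulr_gt0// divr_gt0.
  exists (Num.min d (e / 2 * eps N.+1)).
    by rewrite lt_min d0 mulr_gt0// divr_gt0.
  move=> n; rewrite leq_eqVlt ge_min => /orP[/eqP->|/dN->//].
  by rewrite lexx orbT.
exists d => // x xd; apply: (@le_lt_trans _ _ (e / 2)); last by lra.
apply: gauge_le => n; rewrite ge_min.
have [nN|Nn] := leqP n N.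
  by rewrite ler_pdivrMr// (le_trans (ltW xd) (dN _ nN)) orbT.
rewrite invf_ple ?posrE ?divr_gt0//.
by rewrite (le_trans (ltW (truncnS_gt _)))// ler_nat ltnW.
Qed.

End Gauge.

(* [X] with the metric [gauge eps (mdist x y)]; the positivity proof is a
   parameter so that the metric structure can be inferred from the type. *)
Definition regauged (R : realType) (X : metricType R) (eps : nat -> R)
  (eps_gt0 : forall n, 0 < eps n) : Type := X.

Section Regauged.
Variables (R : realType) (X : metricType R) (eps : nat -> R).
Hypothesis eps_gt0 : forall n, 0 < eps n.
Local Notation Y := (regauged X eps_gt0).

Let dist (x y : Y) : R := gauge eps (mdist (x : X) (y : X)).

Let distxx x : dist x x = 0.
Proof. by rewrite /dist mdistxx gauge0. Qed.

Let dist_positivity x y : dist x y = 0 -> x = y.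
Proof.
move=> xy; apply: (@mdist_positivity R X); apply/eqP; apply: contra_eqT xy => xy.
by rewrite gt_eqF// gauge_gt0// lt_neqAle eq_sym xy mdist_ge0.
Qed.

Let dist_sym x y : dist x y = dist y x.
Proof. by rewrite /dist metric_sym. Qed.

Let dist_triangle y x z : dist x z <= dist x y + dist y z.
Proof.
by apply: gauge_subadditive => //; [exact: mdist_ge0..|exact: metric_triangle].
Qed.

HB.instance Definition _ := Choice.copy Y X.
HB.instance Definition _ :=
  isMetric.Build R Y distxx dist_positivity dist_sym dist_triangle.

End Regauged.

(** * Diameters and uniform continuity *)

Section Diam.
Variables (R : realType) (X : metricType R).
Local Open Scope ereal_scope.
Implicit Types (A : set X) (c : R).

Lemma diam_ge0 A : 0 <= diam A.
Proof. by apply: ereal_sup_ubound; left. Qed.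

Lemma diam_ge A x y : A x -> A y -> (mdist x y)%:E <= diam A.
Proof.
by move=> Ax Ay; apply: ereal_sup_ubound; right; exists x => //; exists y.
Qed.

Lemma diam_le A c : (0 <= c)%R ->
  (forall x y, A x -> A y -> (mdist x y <= c)%R) -> diam A <= c%:E.
Proof.
move=> c0 Ac; apply: ge_ereal_sup => _ [->|[x Ax [y Ay <-]]]; rewrite lee_fin//.
exact: Ac.
Qed.

End Diam.

Lemma mdist_unif_continuousP (R : realType) (X Y : metricType R) (f : X -> Y) :
  unif_continuous f <-> forall e, 0 < e -> exists2 d, 0 < d &
    forall x y, mdist x y < d -> mdist (f x) (f y) < e.
Proof.
split=> [/unif_continuousP fu e /fu[d d0 fd]|fu].
  by exists d => // x y xy; have := fd (x, y); rewrite !ballEmdist; exact.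
apply/unif_continuousP => e /fu[d d0 fd]; exists d => // -[x y].
by rewrite !ballEmdist; exact: fd.
Qed.

(** * Covers, Hausdorff measure and the two implications *)

Section StrongMeasureZero.
Variable R : realType.
Implicit Types X Y : metricType R.

(** One point from each nonempty member of the covers of mesh [1/(n+1)] gives a countable dense
    set. *)
Lemma strong_measure_zero_separable X :
  strong_measure_zero X -> separable_space X.
Proof.
move=> smz.
have /choice[U UP] n : exists V : nat -> set X, [set: X] `<=` \bigcup_k V k /\
    forall k, (diam (V k) <= (n.+1%:R^-1)%:E)%E.
  by apply: (smz (fun=> n.+1%:R^-1)) => _; rewrite invr_gt0.
have [x0|X0] := pselect (exists x : X, True); last first.
  by exists set0 => // O [x _]; case: X0; exists x.
have /choice[g gP] (p : nat * nat) : exists x : X,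
    U p.1 p.2 !=set0 -> U p.1 p.2 x.
  have [[x Ux]|U0] := pselect (U p.1 p.2 !=set0); first by exists x.
  by case: x0 => x _; exists x.
exists (range g).
  by apply: card_le_trans (card_image_le _ _) _; exact: countableP.
move=> O [x Ox] oO.
have : nbhs x O by apply: open_nbhs_nbhs; split.
move=> /nbhs_ballP[e /= e0 eO].
pose n := Num.truncn e^-1; have [Ucov Udiam] := UP n.
have [k _ Ux] := Ucov x I.
have Ug := gP (n, k) (ex_intro _ x Ux).
exists (g (n, k)); split; last by exists (n, k).
apply: eO; rewrite ballEmdist/=.
have := le_trans (diam_ge Ux Ug) (Udiam k); rewrite lee_fin => /le_lt_trans; apply.
by rewrite invf_plt ?posrE// truncnS_gt.
Qed.

Lemma strong_measure_zero_image X Y (f : X -> Y) (eps : nat -> R) :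
  strong_measure_zero X -> unif_continuous f -> (forall n, 0 < eps n) ->
  exists U : nat -> set Y, range f `<=` \bigcup_n U n /\
    forall n, (diam (U n) <= (eps n)%:E)%E.
Proof.
move=> smz /mdist_unif_continuousP fu eps0.
have /choice[d dP] n : exists d, 0 < d /\
    forall x y, mdist x y < d -> mdist (f x) (f y) < eps n.
  by have [d d0 fd] := fu _ (eps0 n); exists d.
(* Halving turns the bound [<=] on diameters into the strict one that the modulus [d n] requires. *)
have [n|U [Ucov Udiam]] := smz (fun n => d n / 2).
  by rewrite divr_gt0//; case: (dP n).
exists (fun n => f @` U n); split.
  by move=> _ [x _ <-]; have [n _ Ux] := Ucov x I; exists n => //; exists x.
move=> n; have [d0 fd] := dP n.
apply: diam_le => [|_ _ [x Ux <-] [y Uy <-]]; first exact: ltW.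
apply/ltW/fd; have := le_trans (diam_ge Ux Uy) (Udiam n); rewrite lee_fin.
by move/le_lt_trans; apply; lra.
Qed.

Local Open Scope ereal_scope.

Lemma hausdorff_content_ge0 X (s delta : R) (E : set X) :
  0 <= hausdorff_content s delta E.
Proof.
apply: le_ereal_inf_tmp => _ [U _ <-].
by apply: nneseries_ge0 => n _ _; exact: poweR_ge0.
Qed.

Lemma strong_measure_zero_hausdorff_measure X Y (f : X -> Y) (s : R) :
  strong_measure_zero X -> unif_continuous f -> (0 < s)%R ->
  hausdorff_measure s (range f) = 0.
Proof.
move=> smz fu s0; apply/eqP; rewrite eq_le; apply/andP; split; last first.
  apply: (le_trans (hausdorff_content_ge0 s 1 (range f))).
  by apply: ereal_sup_ubound; exists 1%R => //=.
apply: ge_ereal_sup => _ [d /= d0 <-]; apply/lee_addgt0Pr => e e0; rewrite add0e.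
pose c n := (e / (2 ^ (n + 1))%:R)%R.
have c0 n : (0 < c n)%R by rewrite divr_gt0// ltr0n expn_gt0.
(* The bound [d] makes the cover admissible for the content; the other makes the [s]-th power of the
   diameter at most [c n], and the [c n] sum to [e]. *)
have [n|U [Ucov Udiam]] :=
    @strong_measure_zero_image X Y f (fun n => Num.min d (c n `^ s^-1)%R) smz fu.
  by rewrite lt_min d0 powR_gt0.
apply: (@le_trans _ _ (\sum_(0 <= n <oo) (diam (U n) `^ s))).
  apply: ereal_inf_lbound; exists U => //; split => // n.
  by apply: le_trans (Udiam n) _; rewrite lee_fin ge_min lexx.
apply: (@le_trans _ _ (\sum_(0 <= n <oo) (c n)%:E)).
  apply: lee_nneseries => [n _ _|n _]; first exact: poweR_ge0.
  have -> : c n = ((c n `^ s^-1) `^ s)%R.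
    by rewrite -powRrM mulVf ?gt_eqF// powRr1// ltW.
  rewrite -poweR_EFin; apply: gt0_ler_poweR; first exact: ltW.
  - by rewrite in_itv/= diam_ge0 leey.
  - by rewrite in_itv/= lee_fin powR_ge0 leey.
  - by apply: le_trans (Udiam n) _; rewrite lee_fin ge_min lexx orbT.
by have /cvg_lim -> // := @cvg_geometric_eseries_half R e 0; rewrite expr0 divr1.
Qed.

Lemma strong_measure_zero_H_null X : strong_measure_zero X -> H_null X.
Proof.
move=> smz; split=> [|Y f fu]; first exact: strong_measure_zero_separable.
apply/eqP; rewrite eq_le; apply/andP; split.
  apply/lee_addgt0Pr => e e0; rewrite add0e; apply: ereal_inf_lbound.
  by exists e => //; split => //; exact: strong_measure_zero_hausdorff_measure fu _.
by apply: le_ereal_inf_tmp => _ [s [s0 _] <-]; rewrite lee_fin ltW.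
Qed.

(* Passes from H^s for some s < 1 to H^1: if diam <= 1 then diam <= diam^s. *)
Lemma hausdorff_dim0_cover X (E : set X) (e : R) :
  (0 < e)%R -> hausdorff_dim E = 0 ->
  exists2 U : nat -> set X, E `<=` \bigcup_n U n &
    exists2 b : nat -> R, (forall n, diam (U n) <= (b n)%:E) &
      forall n, (\sum_(0 <= i < n) b i <= e)%R.
Proof.
move=> e0 dim0.
have /ereal_inf_lt[_ [s [s0 Hs] <-]] : hausdorff_dim E < 1 by rewrite dim0 lte01.
rewrite lte_fin => s1.
have : hausdorff_content s 1 E < e%:E.
  apply: (@le_lt_trans _ _ 0); last by rewrite lte_fin.
  by rewrite -Hs; apply: ereal_sup_ubound; exists 1%R => //=.
move=> /ereal_inf_lt[_ [U [Ecov Udiam] <-]] Usum.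
have Ufin n : (fine (diam (U n)))%:E = diam (U n).
  apply: fineK; rewrite ge0_fin_numE ?diam_ge0//.
  exact: le_lt_trans (Udiam n) (ltry _).
(* The bound [b n] is the [s]-th power of the diameter. Diameter 0 is treated apart, since comparing
   powers uses a positive base. *)
exists U => //; exists (fun n => fine (diam (U n)) `^ s)%R => n.
  rewrite -{1}Ufin lee_fin.
  have : (0 <= fine (diam (U n)))%R by rewrite fine_ge0// diam_ge0.
  rewrite le_eqVlt => /predU1P[<-|U0]; first exact: powR_ge0.
  apply: ger1_powR (ltW s1); rewrite U0/= -lee_fin Ufin; exact: Udiam.
rewrite -lee_fin -sumEFin; apply: le_trans (ltW Usum).
under eq_bigr do rewrite -poweR_EFin Ufin.
by apply: nneseries_lim_ge => i _ _; exact: poweR_ge0.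
Qed.

(** Telescoping. These weights make the terms to be ranked positive at a total cost of at most
    1/2. *)
Lemma sum_half_powers n : (\sum_(0 <= i < n) (2^-1 : R) ^+ i.+2 <= 2^-1)%R.
Proof.
suff -> : (\sum_(0 <= i < n) (2^-1 : R) ^+ i.+2 = 2^-1 - 2^-1 ^+ n.+1)%R.
  by rewrite gerBl exprn_ge0// invr_ge0.
elim: n => [|n IH]; first by rewrite big_geq// expr1 subrr.
by rewrite big_nat_recr//= IH !exprS; lra.
Qed.

Lemma H_null_strong_measure_zero X : H_null X -> strong_measure_zero X.
Proof.
move=> [_ Xnull] eps eps0.
pose f : X -> regauged X eps0 := id.
have fu : unif_continuous f.
  apply/mdist_unif_continuousP => e /(gauge_near0 eps0)[d d0 dP].
  by exists d => // x y; exact: dP.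
have h0 : (0 < 2^-1 :> R)%R by rewrite invr_gt0.
(* The budget 1/2 leaves room for the positive weights added below, keeping the total at most 1. *)
have [U Ucov [b Ub bsum]] := hausdorff_dim0_cover h0 (Xnull _ _ fu).
(* The rank requires positive terms, but [b n] may vanish. *)
pose a n := (b n + 2^-1 ^+ n.+2)%R.
have ab n : (b n < a n)%R by rewrite ltrDl exprn_gt0.
have b0 n : (0 <= b n)%R by rewrite -lee_fin (le_trans (diam_ge0 _) (Ub n)).
have a0 n : (0 < a n)%R := le_lt_trans (b0 n) (ab n).
have asum n : (\sum_(0 <= i < n) a i <= 1)%R.
  rewrite big_split/=; apply: le_trans (lerD (bsum n) (sum_half_powers n)) _.
  by lra.
have [r rinj ra] := summable_rank a0 asum.
(* The [n]-th set is the member of rank [n], or empty if no member has that rank. Injectivity of [r]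
   puts any two of its points in the same [U k]. *)
exists (fun n => [set x | exists2 k, r k = n & U k x]); split.
  move=> x _; have [k _ Ux] : (\bigcup_n U n) (f x) by apply: Ucov; exists x.
  by exists (r k) => //; exists k.
move=> n; apply: diam_le => [|x y [k <- Ux] [j /rinj-> Uy]]; first exact: ltW.
(* The new distance is at most [b k < a k <= 1/(r k + 1)]; the added weight supplies the strict
   inequality. *)
apply: (gauge_lt_inv eps0); apply: lt_le_trans (ra k); apply: le_lt_trans (ab k).
by rewrite -lee_fin; apply: le_trans (Ub k); exact: (diam_ge Ux Uy).
Qed.

End StrongMeasureZero.

Theorem theorem4p3 (R : realType) (X : metricType R) :
  H_null X <-> strong_measure_zero X.
Proof.
split; first exact: H_null_strong_measure_zero.
exact: strong_measure_zero_H_null.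
Qed.
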